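(* Let $q$ be a power of an odd prime. If $q \equiv 3 \pmod 4$ and $a,b \in \mathbb{F}_q$ satisfy $a^2+b^2=-1$, then the vector $(a,b,-1)^T \in \mathbb{F}_q^3$ cannot be written as the sum of two unit vectors, though it can be written as a sum of three unit vectors. In particular, the following result is best possible for all values of $q$: ''every vector in $\mathbb{F}_q^3$ is the sum of $3$ unit vectors if $q \equiv 3 \pmod 4$ and of $2$ unit vectors if $q \equiv 1 \pmod 4$''; that is, the number $3$ (respectively $2$) cannot be replaced by a smaller positive integer.
   Context: For $x \in \mathbb{F}_q^d$, $\|x\| = x_1^2+\dots+x_d^2 \in \mathbb{F}_q$, and $x$ is a unit vector if and only if $\|x\| = 1$. ''$x$ is the sum of $m$ unit vectors'' means $x = u_1+\dots+u_m$ with each $u_j$ a unit vector in the same space, repetitions allowed. *)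

(* Defs.v *)
From HB Require Import structures.
From mathcomp Require Import all_boot all_order all_algebra.
Set Implicit Arguments.
Unset Strict Implicit.
Unset Printing Implicit Defensive.
Import GRing.Theory.
Local Open Scope ring_scope.

(* The paper's ||x||: no square root is taken, the value lies in F. *)
Definition sqnorm (F : finFieldType) (d : nat) (x : 'cV[F]_d) : F :=
  \sum_(i < d) x i 0 ^+ 2.

Definition unit_vector (F : finFieldType) (d : nat) (x : 'cV[F]_d) : Prop :=
  sqnorm x = 1.

Definition sum_of_unit_vectors (F : finFieldType) (d m : nat)
    (x : 'cV[F]_d) : Prop :=
  exists u : 'I_m -> 'cV[F]_d,
    (forall j, unit_vector (u j)) /\ x = \sum_(j < m) u j.

(* Main.v *)
Require Import Defs.
From HB Require Import structures.
From mathcomp Require Import all_boot all_order all_algebra.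
From mathcomp Require Import finfield ring zify.
Set Implicit Arguments.
Unset Strict Implicit.
Unset Printing Implicit Defensive.
Import GRing.Theory.
Local Open Scope ring_scope.

(** The vector v = (a, b, -1) is isotropic.  If v = u + w with u and w unit
    vectors, then 1 = ||v - u|| = 1 - 2 (u . v), so u lies in the plane
    orthogonal to v.  That plane contains the isotropic v, so the form
    degenerates on it to the square of one linear form times a constant, and
    this constant is -1: by Lagrange's identity
    (a^2 + b^2) (x^2 + y^2) = (a x + b y)^2 + (b x - a y)^2,
    a vector (x, y, a x + b y) of the plane has norm -(b x - a y)^2.  A unit
    vector in it would make -1 a square, against q = 3 mod 4.  This is
    [isotropic_not_sum_two_units].

    For three units, (0, 0, -1) is itself a unit vector, and the remainder
    (a, b, 0), of norm -1, is the sum of its half plus and minus an orthogonal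
    vector of norm 1 + 1/4; the hyperbolic plane spanned by (-b, a, 0) and
    (0, 0, 1) contains such a vector ([isotropic_sum_three_units]).

    Optimality at q = 3 mod 4 also needs such a and b to exist
    ([sum_two_sqr_eqN1]); a single unit vector never suffices because 0 has
    norm 0. *)

Lemma odd_pchar_two_neq0 (F : finFieldType) (p : nat) :
  odd p -> p \in [pchar F] -> (2 : F) != 0.
Proof.
move=> p_odd charFp; rewrite -(dvdn_pcharf charFp); apply/negP => p_dvd2.
have p_prime := pcharf_prime charFp.
by move: p_dvd2; rewrite dvdn_prime2 // => /eqP p2; move: p_odd; rewrite p2.
Qed.

(** For y nonzero, y^((q-1)/2) = e with e = 1 or e = -1, so y^((q+1)/2) = e y; as
    q = 3 mod 4, the exponent (q+1)/2 is even and e y is the square of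
    y^((q+1)/4). *)
Lemma sqrt_opp_or_id (F : finFieldType) (y : F) :
  (#|F| %% 4 = 3)%N -> exists c : F, c ^+ 2 = y \/ c ^+ 2 = - y.
Proof.
move=> cardF3; have [-> | y_neq0] := eqVneq y 0.
  by exists 0; left; rewrite expr0n.
have [n cardFE] : exists n, #|F| = (4 * n + 3)%N.
  by exists (#|F| %/ 4)%N; lia.
have y_fermat : y ^+ (2 * n + 1) ^+ 2 = 1.
  apply: (mulfI y_neq0); rewrite mulr1 -exprM -exprS -[RHS]expf_card cardFE.
  by congr (_ ^+ _); lia.
exists (y ^+ n.+1).
have -> : y ^+ n.+1 ^+ 2 = y ^+ (2 * n + 1) * y.
  by rewrite -exprM -exprSr; congr (_ ^+ _); lia.
move/eqP: y_fermat; rewrite sqrf_eq1 => /orP[] /eqP ->.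
  by left; rewrite mul1r.
by right; rewrite mulN1r.
Qed.

(** If c^2 = -1 then c^(q-1) = (-1)^((q-1)/2) = -1, as (q-1)/2 is odd, against
    Fermat. *)
Lemma sqr_neqN1 (F : finFieldType) (c : F) :
  (2 : F) != 0 -> (#|F| %% 4 = 3)%N -> c ^+ 2 <> -1.
Proof.
move=> two_neq0 cardF3 cc.
have [n cardFE] : exists n, #|F| = (4 * n + 3)%N.
  by exists (#|F| %/ 4)%N; lia.
have := expf_card c; rewrite cardFE.
have -> : (4 * n + 3 = (2 * (2 * n + 1)).+1)%N by lia.
rewrite exprSr exprM cc -signr_odd oddD oddM /= expr1 mulN1r => cN.
have /eqP : 2 * c = 0 by rewrite mulr_natl mulr2n -{1}cN addNr.
rewrite mulf_eq0 (negPf two_neq0) /= => /eqP c0.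
by move/eqP: cc; rewrite c0 expr0n /= eq_sym oppr_eq0 oner_eq0.
Qed.

(** Otherwise the set of squares is stable under adding 1: if c^2 + 1 were not
    a square, its opposite would be some d^2, and c^2 + d^2 = -1.  Then every
    n%:R is a square, in particular (p - 1)%:R = -1. *)
Lemma sum_two_sqr_eqN1 (F : finFieldType) :
  (2 : F) != 0 -> (#|F| %% 4 = 3)%N ->
  exists a b : F, a ^+ 2 + b ^+ 2 = -1.
Proof.
move=> two_neq0 cardF3.
have [p p_prime charFp] := finPcharP F.
have [/existsP[[a b] /eqP ab] | no_ab] :=
  boolP [exists ab : F * F, ab.1 ^+ 2 + ab.2 ^+ 2 == -1]; first by exists a, b.
exfalso.
have nat_sqr n : exists c : F, c ^+ 2 = n%:R.
  elim: n => [|n [c cc]]; first by exists 0; rewrite expr0n.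
  have [d [dd | dd]] := sqrt_opp_or_id (n.+1%:R : F) cardF3.
    by exists d.
  case/negP: no_ab; apply/existsP; exists (c, d).
  by rewrite /= cc dd -natr1; apply/eqP; ring.
have [c cc] := nat_sqr p.-1.
apply: (sqr_neqN1 two_neq0 cardF3 (c := c)); rewrite cc.
apply: (addIr 1); rewrite natr1 prednK ?prime_gt0 // addNr.
exact: pcharf0.
Qed.

Lemma sqnorm3 (F : finFieldType) (x : 'cV[F]_3) :
  sqnorm x = x 0 0 ^+ 2 + x 1 0 ^+ 2 + x 2 0 ^+ 2.
Proof.
rewrite /sqnorm !big_ord_recl big_ord0 addr0 addrA.
by congr (_ + x _ 0 ^+ 2 + x _ 0 ^+ 2); apply: val_inj.
Qed.

Lemma isotropic_not_sum_two_units (F : finFieldType) (a b : F) :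
  (2 : F) != 0 -> (#|F| %% 4 = 3)%N -> a ^+ 2 + b ^+ 2 = -1 ->
  ~ sum_of_unit_vectors 2 (\col_(i < 3) [:: a; b; -1]`_i).
Proof.
move=> two_neq0 cardF3 ab [u [u_unit v_eq]].
have coord (i : 'I_3) : [:: a; b; -1]`_i = u 0 i 0 + u 1 i 0.
  move/colP/(_ i): v_eq; rewrite mxE !big_ord_recl big_ord0 addr0 mxE => ->.
  by congr (_ + u _ i 0); apply: val_inj.
have := u_unit 0; have := u_unit 1; rewrite /unit_vector !sqnorm3.
have := coord 0; have := coord 1; have := coord 2; rewrite /=.
move: (u 0 0 0) (u 0 1 0) (u 0 2 0) (u 1 0 0) (u 1 1 0) (u 1 2 0).
move=> x y z x' y' z' zE yE xE w_unit xyz_unit.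
have orth : a * x + b * y = z.
  apply/eqP; rewrite -subr_eq0 -(mulrI_eq0 _ (mulfI two_neq0)); apply/eqP.
  have x'E : x' = a - x by rewrite xE; ring.
  have y'E : y' = b - y by rewrite yE; ring.
  have z'E : z' = -1 - z by rewrite zE; ring.
  transitivity ((a ^+ 2 + b ^+ 2 - -1) + (x ^+ 2 + y ^+ 2 + z ^+ 2)
                  - (x' ^+ 2 + y' ^+ 2 + z' ^+ 2)).
    by rewrite x'E y'E z'E; ring.
  by rewrite ab w_unit xyz_unit addrK subrr.
(* Lagrange's identity turns a^2 + b^2 = -1 and u . v = 0 into
   (b x - a y)^2 = -||u||. *)
apply: (sqr_neqN1 two_neq0 cardF3 (c := b * x - a * y)).
transitivity ((a ^+ 2 + b ^+ 2) * (x ^+ 2 + y ^+ 2) - (a * x + b * y) ^+ 2).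
  by ring.
by rewrite ab orth mulN1r -xyz_unit; ring.
Qed.

(** An orthogonal correction s (-b, a, 0) + r (0, 0, 1) to the half of (a, b, 0)
    has norm r^2 - s^2, which must be 5/4.  Factoring it as (r - s) (r + s) with
    r - s = 1 and r + s = 5/4 gives r = 9/8 and s = 1/8. *)
Lemma isotropic_sum_three_units (F : finFieldType) (a b : F) :
  (2 : F) != 0 -> a ^+ 2 + b ^+ 2 = -1 ->
  sum_of_unit_vectors 3 (\col_(i < 3) [:: a; b; -1]`_i).
Proof.
move=> two_neq0 ab.
have pow2_neq0 n : (2 ^ n)%:R != 0 :> F by rewrite natrX expf_neq0.
(* Here s = 1 or -1 is the sign of the orthogonal correction. *)
pose t (s : F) := \col_(i < 3)
  [:: a / 2 - s * b / 8; b / 2 + s * a / 8; s * 9 / 8]`_i.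
pose e : 'cV[F]_3 := \col_(i < 3) [:: 0; 0; -1]`_i.
have t_unit s : s ^+ 2 = 1 -> unit_vector (t s).
  move=> ss; rewrite /unit_vector sqnorm3 !mxE /=.
  transitivity ((a ^+ 2 + b ^+ 2) * (1 / 4 + s ^+ 2 / 64) + 81 / 64 * s ^+ 2).
    by field; rewrite two_neq0 (pow2_neq0 2) (pow2_neq0 3) (pow2_neq0 6).
  by rewrite ab ss; field; rewrite (pow2_neq0 2) (pow2_neq0 6).
exists (fun j : 'I_3 => [:: e; t 1; t (-1)]`_j); split=> [j|].
  case: j => [[|[|[|//]]] lt_j3] /=.
  - by rewrite /unit_vector sqnorm3 !mxE /=; ring.
  - by apply: t_unit; rewrite expr1n.
  - by apply: t_unit; rewrite sqrrN expr1n.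
apply/colP => i; rewrite !big_ord_recl big_ord0 !mxE.
by case: i => [[|[|[|//]]] lt_i3] /=; field;
   rewrite ?two_neq0 ?(pow2_neq0 3).
Qed.

Lemma zero_not_unit (F : finFieldType) (d : nat) :
  ~ unit_vector (0 : 'cV[F]_d).
Proof.
rewrite /unit_vector /sqnorm big1 => [/eqP|i _]; last by rewrite mxE expr0n.
by rewrite eq_sym oner_eq0.
Qed.

Lemma zero_not_one_unit_sum (F : finFieldType) (d : nat) :
  ~ (forall x : 'cV[F]_d, sum_of_unit_vectors 1 x).
Proof.
move=> /(_ 0)[u [u_unit]]; rewrite big_ord1 => u0.
by apply: (@zero_not_unit F d); rewrite u0.
Qed.

Theorem proposition1p8 (p k q : nat) (F : finFieldType)
    (p_prime : prime p) (p_odd : odd p) (k_gt0 : (0 < k)%N)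
    (q_def : q = (p ^ k)%N) (cardF : #|F| = q) :
  ((q %% 4 = 3)%N ->
    forall a b : F, a ^+ 2 + b ^+ 2 = -1 ->
      ~ sum_of_unit_vectors 2 (\col_(i < 3) [:: a; b; -1]`_i) /\
      sum_of_unit_vectors 3 (\col_(i < 3) [:: a; b; -1]`_i)) /\
  ((q %% 4 = 3)%N ->
    forall m : nat, (0 < m < 3)%N ->
      ~ (forall x : 'cV[F]_3, sum_of_unit_vectors m x)) /\
  ((q %% 4 = 1)%N ->
    forall m : nat, (0 < m < 2)%N ->
      ~ (forall x : 'cV[F]_3, sum_of_unit_vectors m x)).
Proof.
have two_neq0 : (2 : F) != 0.
  by apply: (odd_pchar_two_neq0 p_odd); apply: (@card_finPcharP F p k); rewrite ?cardF.
rewrite -{}cardF in q_def *; split; [|split].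
- move=> q3 a b ab; split; first exact: isotropic_not_sum_two_units.
  exact: isotropic_sum_three_units.
- move=> q3 [|[|[|//]]] // _; first exact: zero_not_one_unit_sum.
  have [a [b ab]] := sum_two_sqr_eqN1 two_neq0 q3.
  by move=> all2; apply: (isotropic_not_sum_two_units two_neq0 q3 ab).
- by move=> _ [|[|//]] // _; apply: zero_not_one_unit_sum.
Qed.
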